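(* Let $z\in\mathbb C$ be such that the series defining $\mathcal Q_z$, $$\mathcal Q_zf(x)=\sum_{n=1}^\infty z^n\Big(\frac1{x+n}\Big)^2f\Big(\frac1{x+n}\Big),$$ is absolutely convergent. Then $$(1-\mathcal Q_z)(1-z\mathcal P_0)=1-z\mathcal P$$ and $$(1-z\,\mathcal S)(1-\mathcal Q_z)=1-z\,\widetilde{\mathcal P},$$ where $\widetilde{\mathcal P}=\mathcal S+\mathcal P_1$.
   Context: The operators act on complex-valued functions $f$ by $$\mathcal P_0f(x)=\Big(\frac1{x+1}\Big)^2f\Big(\frac x{x+1}\Big),\quad \mathcal P_1f(x)=\Big(\frac1{x+1}\Big)^2f\Big(\frac1{x+1}\Big),\quad \mathcal P=\mathcal P_0+\mathcal P_1,\quad \mathcal Sf(x)=f(x+1).$$ One has $\mathcal Q_z=\sum_{n\ge1}z^n\mathcal P_1\mathcal P_0^{n-1}$. The relations are algebraic and independent of the function space considered: they are identities between operators applied to functions $f:\Omega\to\mathbb C$ for which the series for $\mathcal Q_zf(x)$ converges absolutely at every $x\in\Omega$, where $\Omega\subset\mathbb C\setminus\{-1\}$ is a set (for instance $\Omega=[0,\infty)$) mapped into itself by $x\mapsto\frac{x}{x+1}$ and $x\mapsto\frac1{x+1}$, and, for the second identity, also by $x\mapsto x+1$. *)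

(* Defs.v *)
From Stdlib Require Import Reals.
From Coquelicot Require Import Coquelicot.

Open Scope R_scope.
Open Scope C_scope.

(* Sum of a complex series, defined from [is_series] in the same way as
   Coquelicot's [RInt] is defined from [is_RInt]; it is meaningful only for
   convergent series. *)
Definition CSeries (a : nat -> C) : C :=
  iota (T := C_CompleteNormedModule)
    (is_series (K := C_AbsRing) (V := C_CompleteNormedModule) a).

Lemma CSeries_unique (a : nat -> C) (l : C) :
  is_series (K := C_AbsRing) (V := C_CompleteNormedModule) a l ->
  CSeries a = l.
Proof.
  intros H.
  exact (iota_filterlim_locally (V := C_CompleteNormedModule) (sum_n a) l H).
Qed.

(* A function on a subset Omega of C is represented by a total function C -> C
   whose values outside Omega are irrelevant; two such functions are identified
   when they agree on Omega. *)
Definition eq_on (Omega : C -> Prop) (f g : C -> C) : Prop :=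
  forall x, Omega x -> f x = g x.

Definition operator : Type := (C -> C) -> (C -> C).

Definition op_id : operator := fun f => f.
Definition op_plus (A B : operator) : operator := fun f x => A f x + B f x.
Definition op_minus (A B : operator) : operator := fun f x => A f x - B f x.
Definition op_scal (c : C) (A : operator) : operator := fun f x => c * A f x.
Definition op_comp (A B : operator) : operator := fun f => A (B f).

Declare Scope operator_scope.
Delimit Scope operator_scope with op.
Bind Scope operator_scope with operator.
Notation "1" := op_id : operator_scope.
Notation "A + B" := (op_plus A B) : operator_scope.
Notation "A - B" := (op_minus A B) : operator_scope.
Notation "c *: A" := (op_scal c%C A)
  (at level 40, left associativity) : operator_scope.
Notation "A \o B" := (op_comp A B)
  (at level 50, left associativity) : operator_scope.

Definition P0 : operator := fun f x => (1 / (x + 1)) ^ 2 * f (x / (x + 1)).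
Definition P1 : operator := fun f x => (1 / (x + 1)) ^ 2 * f (1 / (x + 1)).
Definition P : operator := (P0 + P1)%op.
Definition Sh : operator := fun f x => f (x + 1).
Definition Ptilde : operator := (Sh + P1)%op.

Definition Qterm (z : C) (f : C -> C) (x : C) (n : nat) : C :=
  z ^ n * (1 / (x + INR n)) ^ 2 * f (1 / (x + INR n)).

(* The series runs over n >= 1, while [CSeries] and [ex_series] start at 0. *)
Definition Q (z : C) : operator :=
  fun f x => CSeries (fun n => Qterm z f x (S n)).

Definition Q_abs_convergent (Omega : C -> Prop) (z : C) (f : C -> C) : Prop :=
  forall x, Omega x -> ex_series (fun n => Cmod (Qterm z f x (S n))).

(* Main.v *)
(* The n-th term of Q_z f is z^n P_1 P_0^(n-1) f, so replacing f by z P_0 f, or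
   shifting x to x + 1 and multiplying by z, moves the n-th term to the
   (n+1)-st.  Both identities follow from removing the first term z P_1 f of the
   series. *)
Require Import Defs.
From Stdlib Require Import Reals.
From Coquelicot Require Import Coquelicot.
Open Scope R_scope.
Open Scope C_scope.

Local Notation is_Cseries :=
  (is_series (K := C_AbsRing) (V := C_CompleteNormedModule)).

(** Completeness of the complex numbers supplies a limit, and uniqueness of limits identifies it
    with the value picked by [iota]. *)
Lemma is_Cseries_of_abs (a : nat -> C) :
  ex_series (fun n => Cmod (a n)) -> is_Cseries a (CSeries a).
Proof.
  intros Ha.
  destruct (ex_series_le (K := C_AbsRing) (V := C_CompleteNormedModule)
              a (fun n => Cmod (a n))) as [l Hl]; [| exact Ha |].
  - intros n; apply Rle_refl.
  - now rewrite (CSeries_unique a l Hl).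
Qed.

Lemma is_Cseries_tail (a : nat -> C) (l : C) :
  is_Cseries a l -> is_Cseries (fun n => a (S n)) (l - a O).
Proof.
  intros Ha.
  apply (is_series_incr_1 (K := C_AbsRing) (V := C_CompleteNormedModule) a).
  change (is_Cseries a (l - a O + a O)).
  now replace (l - a O + a O) with l by ring.
Qed.

Lemma C_INR_S (n : nat) : RtoC (INR (S n)) = INR n + 1.
Proof. now rewrite S_INR, RtoC_plus. Qed.

Lemma Cdenom_neq_0 (x : C) : x <> RtoC (-1) -> x + 1 <> 0.
Proof.
  intros Hx H; apply Hx.
  replace x with (x + 1 - 1) by ring.
  rewrite H; apply injective_projections; simpl; ring.
Qed.

Section Invariant_domain.

Variable Omega : C -> Prop.
Hypothesis Omega_m1 : forall x : C, Omega x -> x <> RtoC (-1).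
Hypothesis Omega_0 : forall x : C, Omega x -> Omega (x / (x + 1)).
Hypothesis Omega_1 : forall x : C, Omega x -> Omega (1 / (x + 1)).

(* 1/(x+n+1) is the image of 1/(x+n) under u |-> u/(u+1), so the whole sequence
   stays in Omega, where it never takes the value -1. *)
Lemma Omega_inv_shift (x : C) (n : nat) :
  Omega x -> x + INR (S n) <> 0 /\ Omega (1 / (x + INR (S n))).
Proof.
  intros Hx; induction n as [|n [Hn0 Hn]].
  - simpl INR; split; [apply Cdenom_neq_0 | apply Omega_1]; auto.
  - rewrite (C_INR_S (S n)), Cplus_assoc.
    set (w := x + INR (S n)) in *.
    (* If w + 1 = 0, then 1/w = -1, although 1/w lies in [Omega]. *)
    assert (Hw : w + 1 <> 0).
    { intros H. apply (Cdenom_neq_0 _ (Omega_m1 _ Hn)).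
      replace (1 / w + 1) with ((w + 1) / w) by (field; exact Hn0).
      rewrite H; field; exact Hn0. }
    split; [exact Hw |].
    replace (1 / (w + 1)) with ((1 / w) / (1 / w + 1)).
    + now apply Omega_0.
    + field; repeat split; auto; rewrite Cplus_comm; auto.
Qed.

(** With w = x + n + 1, the weight of [P0] at 1/w is (w/(w+1))^2. Its numerator cancels the factor
    (1/w)^2 of the term, leaving the weight (1/(w+1))^2 of the next one. *)
Lemma Qterm_sub_P0 (z : C) (f : C -> C) (x : C) (n : nat) :
  Omega x ->
  Qterm z ((1 - z *: P0)%op f) x (S n) =
  Qterm z f x (S n) - Qterm z f x (S (S n)).
Proof.
  intros Hx.
  destruct (Omega_inv_shift x n Hx) as [Hw _].
  destruct (Omega_inv_shift x (S n) Hx) as [Hw1 _].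
  unfold Qterm, op_minus, op_scal, op_id, P0.
  rewrite (C_INR_S (S n)), Cplus_assoc in *.
  set (w := x + INR (S n)) in *.
  replace ((1 / w) / (1 / w + 1)) with (1 / (w + 1))
    by (field; repeat split; auto; rewrite Cplus_comm; auto).
  change (z ^ S (S n)) with (z * z ^ S n).
  (* Keeps this power atomic, so that [simpl Cpow] expands only the squares. *)
  set (zn := z ^ S n).
  simpl Cpow; field; repeat split; auto; rewrite Cplus_comm; auto.
Qed.

End Invariant_domain.

Lemma Qterm_shift (z : C) (f : C -> C) (x : C) (n : nat) :
  z * Qterm z f (x + 1) n = Qterm z f x (S n).
Proof.
  unfold Qterm; rewrite C_INR_S.
  replace (x + 1 + INR n) with (x + (INR n + 1)) by ring.
  change (z ^ S n) with (z * z ^ n); ring.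
Qed.

Lemma Qterm_1 (z : C) (f : C -> C) (x : C) : Qterm z f x 1 = z * P1 f x.
Proof. unfold Qterm, P1; simpl INR; simpl Cpow; ring. Qed.

Theorem proposition1 (Omega : C -> Prop)
  (Omega_m1 : forall x : C, Omega x -> x <> RtoC (-1))
  (Omega_0 : forall x : C, Omega x -> Omega (x / (x + 1)))
  (Omega_1 : forall x : C, Omega x -> Omega (1 / (x + 1)))
  (z : C) (f : C -> C)
  (f_conv : Q_abs_convergent Omega z f) :
  (Q_abs_convergent Omega z ((1 - z *: P0)%op f) /\
   eq_on Omega (((1 - Q z) \o (1 - z *: P0))%op f) ((1 - z *: P)%op f)) /\
  ((forall x : C, Omega x -> Omega (x + 1)) ->
   eq_on Omega (((1 - z *: Sh) \o (1 - Q z))%op f)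
               ((1 - z *: Ptilde)%op f)).
Proof.
  assert (sum_f : forall x, Omega x ->
    is_Cseries (fun n => Qterm z f x (S n)) (Q z f x)).
  { intros x Hx; apply is_Cseries_of_abs; auto. }
  assert (sum_tail : forall x, Omega x ->
    is_Cseries (fun n => Qterm z f x (S (S n))) (Q z f x - z * P1 f x)).
  { intros x Hx; rewrite <- Qterm_1.
    exact (is_Cseries_tail _ _ (sum_f x Hx)). }
  split; [split |].
  (* This makes the composition meaningful: [Q z] is then applied to a function whose series
     converges. The terms are dominated by the sum of the original series of moduli and its tail. *)
  - intros x Hx.
    apply (ex_series_le (K := R_AbsRing) (V := R_CompleteNormedModule) _
             (fun n => plus (Cmod (Qterm z f x (S n)))
                            (Cmod (Qterm z f x (S (S n)))))).
    + intros n; rewrite (Qterm_sub_P0 Omega) by assumption.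
      change (Rabs (Cmod (Qterm z f x (S n) - Qterm z f x (S (S n)))) <=
        Cmod (Qterm z f x (S n)) + Cmod (Qterm z f x (S (S n))))%R.
      rewrite Rabs_pos_eq by apply Cmod_ge_0.
      rewrite <- (Cmod_opp (Qterm z f x (S (S n)))).
      apply Cmod_triangle.
    + apply (ex_series_plus (K := R_AbsRing) (V := R_NormedModule)).
      * exact (f_conv x Hx).
      * apply (ex_series_incr_1 (K := R_AbsRing) (V := R_NormedModule)
                 (fun n => Cmod (Qterm z f x (S n)))).
        exact (f_conv x Hx).
  - intros x Hx.
    (* The series telescopes: the full sum minus its tail is the first term. *)
    assert (HQ : Q z ((1 - z *: P0)%op f) x = z * P1 f x).
    { apply CSeries_unique.
      replace (z * P1 f x) with (Q z f x - (Q z f x - z * P1 f x)) by ring.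
      eapply is_series_ext;
        [| exact (is_series_minus _ _ _ _ (sum_f x Hx) (sum_tail x Hx))].
      intros n; symmetry; apply (Qterm_sub_P0 Omega); assumption. }
    (* Only the outer factor is unfolded, so that the inner operator still matches [HQ]. *)
    unfold op_comp, op_minus at 1, op_id at 1; rewrite HQ.
    unfold P, op_minus, op_plus, op_scal, op_id; ring.
  - intros Omega_S x Hx.
    (* Both sides are the sum of the tail at x; the left one uses convergence at x + 1, which lies
       in [Omega] by [Omega_S]. *)
    assert (HQ : z * Q z f (x + 1) = Q z f x - z * P1 f x).
    { rewrite <- (CSeries_unique _ _ (sum_tail x Hx)); symmetry.
      apply CSeries_unique.
      eapply is_series_ext;
        [| exact (is_series_scal z _ _ (sum_f (x + 1) (Omega_S x Hx)))].
      intros n; exact (Qterm_shift z f x (S n)). }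
    unfold Ptilde, Sh, op_comp, op_minus, op_plus, op_scal, op_id.
    (* Distributes z to expose the left side of [HQ]. *)
    transitivity (f x - Q z f x - z * f (x + 1) + z * Q z f (x + 1)); [ring |].
    rewrite HQ; ring.
Qed.
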